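(* Let $d\ge 3$, $1\le k\le\lceil\frac{d-2}{2}\rceil$, $n,m\ge 1$, and $f_{a,c}(z)=a\,\mathcal{B}_{d,k}(z)+c$. Let $\alpha,\beta\in\overline{\mathbb{Q}}$ satisfy $F_n(\alpha,\beta)=G_m(\alpha,\beta)=0$, and let $\mathfrak p$ be a prime ideal of $\mathbb{Q}(\alpha,\beta)$ that is index divisor free for $(d,k)$. Then $\alpha$ and $\beta$ are $\mathfrak p$-adically integral, i.e. $v_{\mathfrak p}(\alpha)\ge 0$ and $v_{\mathfrak p}(\beta)\ge 0$.
   Context: The normalized Belyi polynomial is $$\mathcal{B}_{d,k}(z)=\sum_{i=0}^{k}\frac{(-1)^{k-i}}{(k-i)!\,i!}\Big(\prod_{0\le j\le k,\ j\ne i}(d-j)\Big)z^{d-i}.$$ With $f^n$ denoting the $n$-th iterate, $F_n(a,c)=f^n_{a,c}(0)$ and $G_m(a,c)=f^m_{a,c}(1)-1$, regarded as polynomials in $a,c$. Index divisor free (IDF) prime ideal: let $L$ be a number field and $\mathfrak p$ a nonzero prime ideal of its ring of integers, with normalized valuation $v_{\mathfrak p}$ (value group $\mathbb{Z}$) and residue characteristic $p$. Then $\mathfrak p$ is index divisor free for $(d,k)$ if: (i) $p>k$; (ii) $\mathfrak p$ divides $d-r$ for some integer $r$ with $0\le r\le k$ (this $r$ is unique since $p>k$); (iii) for this $r$, $r\nmid v_{\mathfrak p}(d-r)$ (with the convention that $0$ divides only $0$). For $L=\mathbb{Q}$ this is the notion of an IDF prime. *)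

(* Defs.v *)
From HB Require Import structures.
From mathcomp Require Import all_boot all_order all_algebra all_field.
From mathcomp Require Import boolp classical_sets.
From mathcomp Require Import mpoly.

Set Implicit Arguments.
Unset Strict Implicit.
Unset Printing Implicit Defensive.

Import Order.TTheory GRing.Theory Num.Theory.

Local Open Scope classical_set_scope.
Local Open Scope ring_scope.

Section BelyiFamily.

Variables d k : nat.

Definition belyi : {poly rat} :=
  \sum_(i < k.+1)
    ((-1) ^+ (k - i) / ((k - i)`! * i`!)%:R
      * \prod_(j < k.+1 | j != i) (d%:R - j%:R)) *: 'X^(d - i).

Definition belyi_map (A : comAlgType rat) (a c z : A) : A :=
  a * horner_alg z belyi + c.

(* In {mpoly rat[2]} the indeterminate of index 0 stands for a, and the one
   of index 1 for c. *)
Definition belyi_generic (z : {mpoly rat[2]}) : {mpoly rat[2]} :=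
  belyi_map 'X_ord0 'X_ord_max z.

Definition F (n : nat) : {mpoly rat[2]} := iter n belyi_generic 0.

Definition G (m : nat) : {mpoly rat[2]} := iter m belyi_generic 1 - 1.

End BelyiFamily.

Definition eval2 (p : {mpoly rat[2]}) (x y : algC) : algC :=
  mmap ratr (tnth [tuple x; y]) p.

Section NumberField.

Variable L : fieldExtType rat.
Implicit Types I J P : set L.

Definition ring_of_integers : set L :=
  [set x | integralOver (intr : int -> L) x].

Local Notation O := ring_of_integers.

Definition is_ideal I : Prop :=
  [/\ I `<=` O,
      I 0,
      forall x y, I x -> I y -> I (x + y)
    & forall x y, O x -> I y -> I (x * y)].

Definition is_nonzero_prime P : Prop :=
  [/\ is_ideal P,
      ~ P 1,
      forall x y, O x -> O y -> P (x * y) -> P x \/ P y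
    & exists2 x, P x & x != 0].

Definition ideal_mul I J : set L :=
  [set x | exists2 s : seq (L * L),
     forall u, u \in s -> I u.1 /\ J u.2 & x = \sum_(u <- s) u.1 * u.2].

Definition ideal_exp P (e : nat) : set L := iter e (ideal_mul P) O.

(* For nonzero y in the ring of integers, this says that P ^ e is the exact
   power of P dividing the principal ideal (y). *)
Definition exact_power P (y : L) (e : nat) : Prop :=
  ideal_exp P e y /\ ~ ideal_exp P e.+1 y.

(* Normalized P-adic valuation of x != 0, computed from any expression of x as
   a quotient of nonzero integers of L.  The infinite valuation of 0 is not
   represented: valuation P 0 is a default value without meaning. *)
Definition valuation P (x : L) : int :=
  xget 0 [set v : int | exists (y z : L) (e f : nat),
     [/\ O y /\ O z, z != 0, x = y / z,
         exact_power P y e /\ exact_power P z f & v = e%:Z - f%:Z]].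

(* 0 has infinite valuation, hence the restriction to x != 0. *)
Definition padic_integral P (x : L) : Prop :=
  x != 0 -> 0 <= valuation P x.

Definition residue_char P (p : nat) : Prop := prime p /\ P p%:R.

(* dvdz satisfies (0 %| v) <-> v = 0, the convention wanted for r = 0. *)
Definition index_divisor_free P (d k : nat) : Prop :=
  is_nonzero_prime P /\
  exists2 p, residue_char P p & (k < p)%N /\
  exists r : nat,
    [/\ (r <= k)%N, P (d%:R - r%:R)
      & ~~ (r%:Z %| valuation P (d%:R - r%:R))%Z].

End NumberField.

(* Main.v *)
Require Import Defs.
From HB Require Import structures.
From mathcomp Require Import all_boot all_order all_algebra all_field.
From mathcomp Require Import boolp classical_sets.
From mathcomp Require Import mpoly.
From mathcomp Require Import zify ring.

Set Implicit Arguments.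
Unset Strict Implicit.
Unset Printing Implicit Defensive.

Import Order.TTheory GRing.Theory Num.Theory.
Local Open Scope ring_scope.

(** Write v for [valuation P], B for the Belyi polynomial, f for the map
    z |-> a B(z) + c, r for the integer at most k with P | d - r, and
    w = v(d - r) > 0.

    The valuations of the coefficients of B are all known
    ([valuation_belyi_coef]).  Because k < p, the factorials in the denominators
    and the differences d - j with j <> r are units at P; so the coefficient of
    z^(d - r) is a unit, and every other coefficient has valuation exactly w.
    Hence, when v(z) < 0, only the terms in z^(d - r) and in z^d can have the
    least valuation, and a tie between them means w = - r v(z), which is excluded
    since r does not divide w.  So no cancellation ever occurs outside the unit
    disc: v(B(z)) is the least of the valuations of the terms
    ([val_sparse_poly]).

    Now let 0 and 1 be periodic under f, which is what F_n = G_m = 0 says.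
    - If v(c) >= 0 > v(a), then f(1) has valuation v(a), and from this level on
      the valuations along the orbit are at most v(a) ([scaled_map_escape]), so 1
      is never reached again.
    - If v(c) < 0, look at f(0) = c.  Either some term of a B(c) has valuation
      below v(c), and then the orbit of 0 escapes in the same way.  Or none has,
      and then f maps the disc v(z) >= v(c) to itself without increasing any
      distance there ([scaled_map_nonexpanding]), and moreover v(a) > 0.  But f
      brings 0 and 1 to the distance v(f(1) - f(0)) = v(a B(1)) = v(a) > 0, while
      a common multiple of their periods brings them back to the distance
      v(1 - 0) = 0: a contradiction.
    Both cases are in [periodic_integral], over any field with a discrete
    valuation.

    It remains to know that v is a valuation ([valuationM], [valuationD_ge]),
    that is, that the localization of the ring of integers at P is a discrete
    valuation ring, and that the powers of its maximal ideal meet the ring of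
    integers in the powers of P ([ideal_expE]).  The usual
    proof takes from the finiteness of the ring of integers over the integers
    that ideals are finitely generated.  Here this is replaced by
    [primitive_relation]: more than [L : Q] elements of L satisfy an integral
    linear relation whose coefficients are not all divisible by p.  Such a
    relation bounds the number of elements of P whose product can be nonzero
    modulo p, locally at P; a longest such product b is killed by P modulo p
    ([pideal_socle]).  Such a relation also shows that g is integral at P when all
    its powers have a common denominator ([almost_integral]).  Applied to
    g = b / p, these two facts produce a generator of the maximal ideal
    ([uniformizer_exists]). *)

(** * Integers of a number field *)

Section RingOfIntegers.

Variable L : fieldExtType rat.
Local Notation O := (@ring_of_integers L).

Lemma intr_fieldExt_eq0 (c : int) : ((c%:~R : L) == 0) = (c == 0).
Proof. by rewrite -(rmorph_int (in_alg L)) fmorph_eq0 intr_eq0. Qed.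

Lemma natrB_neq0 (j n : nat) : (j < n)%N -> n%:R - j%:R != 0 :> L.
Proof.
move=> lt_jn; rewrite -natrB; last exact: ltnW.
by rewrite pmulrn intr_fieldExt_eq0; lia.
Qed.

Lemma integersD x y : O x -> O y -> O (x + y).
Proof. exact: integral_add. Qed.

Lemma integersM x y : O x -> O y -> O (x * y).
Proof. exact: integral_mul. Qed.

Lemma integersN x : O x -> O (- x).
Proof. exact: integral_opp. Qed.

Lemma integers_int (c : int) : O c%:~R.
Proof. exact: (integral_id (intr : int -> L)). Qed.

Lemma integers_nat (n : nat) : O n%:R.
Proof. exact: integral_nat. Qed.

Lemma integers1 : O 1.
Proof. exact: integral1. Qed.

Lemma integers0 : O 0.
Proof. exact: integral0. Qed.

Lemma integersX x n : O x -> O (x ^+ n).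
Proof.
move=> Ox; elim: n => [|n IHn]; rewrite ?expr0 ?exprS.
  exact: integers1.
exact: integersM.
Qed.

Lemma integers_sum (I : Type) (r : seq I) (Q : pred I) (E : I -> L) :
  (forall i, Q i -> O (E i)) -> O (\sum_(i <- r | Q i) E i).
Proof.
by move=> OE; apply: big_ind => //; [exact: integers0 | exact: integersD].
Qed.

Lemma integers_horner (q : {poly int}) x : O x -> O (map_poly intr q).[x].
Proof.
move=> Ox; rewrite horner_coef; apply: integers_sum => i _.
apply: integersM; last exact: integersX.
by rewrite coef_map; apply: integers_int.
Qed.

(** If q has degree n and leading coefficient l, then l^(n - 1) q(x) is a monic
    polynomial in l x, with integral coefficients. *)
Lemma integers_lead_coefM (q : {poly L}) x :
  (forall i, O q`_i) -> root q x -> O (lead_coef q * x).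
Proof.
move=> Oq qx0; have [-> | nzq] := eqVneq q 0.
  by rewrite lead_coef0 mul0r; apply: integers0.
have [n sz_q] : exists n, size q = n.+2.
  case Dn: (size q) => [|[|n]]; last by exists n.
    by move/eqP: Dn; rewrite size_poly_eq0 (negPf nzq).
  move/eqP/size_poly1P: Dn qx0 => [c nzc ->].
  by rewrite rootC (negPf nzc).
set l := lead_coef q; pose e i := if i == n.+1 then 1 else q`_i * l ^+ (n - i).
pose r := \poly_(i < n.+2) e i.
have e_lead : e n.+1 = 1 by rewrite /e eqxx.
have rm : r \is monic.
  by rewrite monicE lead_coef_poly ?e_lead ?oner_neq0.
have Or : {in r : seq L, integralRange (intr : int -> L)}.
  apply/integral_poly => i; rewrite coef_poly; case: ifP => _; last exact: integral0.
  rewrite /e; case: ifP => _; first exact: integral1.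
  by apply: integersM => //; apply: integersX; apply: Oq.
apply: (integral_root_monic rm) Or.
rewrite /root horner_poly (_ : \sum_(i < n.+2) _ = l ^+ n * q.[x]); last first.
  rewrite horner_coef sz_q mulr_sumr; apply: eq_bigr => i _.
  rewrite exprMn /e; case: eqP => [-> | /eqP ne_i].
    by rewrite /l lead_coefE sz_q /= exprS; ring.
  have le_i : (i <= n)%N by rewrite -ltnS ltn_neqAle ne_i -ltnS ltn_ord.
  have -> : l ^+ n = l ^+ (n - i) * l ^+ i by rewrite -exprD subnK.
  by ring.
by move: qx0 => /eqP ->; rewrite mulr0.
Qed.

(** Clear the denominators of a rational linear relation, and divide it by the
    content of its coefficients. *)
Lemma primitive_relation (p : nat) (x : nat -> L) : prime p ->
  exists (n : nat) (c : nat -> int),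
    (exists2 i, (i < n)%N & ~~ (p%:Z %| c i)%Z)
    /\ \sum_(i < n) (c i)%:~R * x i = 0.
Proof.
move=> p_pr; set N := \dim (fullv : {vspace L}).
pose X := [tuple x i | i < N.+1].
have /freeP /existsNP[k /not_implyP[k_rel /existsNP[i0 /eqP nz_i0]]]: ~~ free X.
  apply/negP => /eqP frX; have := dimvS (subvf <<X>>%VS).
  by rewrite frX size_tuple ltnn.
pose r := \poly_(i < N.+1) k (inord i).
have r_i (i : 'I_N.+1) : r`_i = k i by rewrite coef_poly ltn_ord inord_val.
have [q [a nz_a Dr]] := rat_poly_scale r.
have nz_q : q != 0.
  apply: contraNneq nz_i0 => q0.
  by rewrite -r_i Dr q0 map_poly0 scaler0 coef0.
exists N.+1, (fun i => (zprimitive q)`_i); split.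
  apply: contrapT => noi; have: (p%:Z %| zcontents (zprimitive q))%Z.
    rewrite dvdz_contents; apply/polyOverP => i.
    have [lt_iN | le_Ni] := ltnP i N.+1.
      by apply: contrapT => /negP ndv; apply: noi; exists i.
    rewrite (nth_default 0) ?rpred0 // size_zprimitive.
    apply: leq_trans le_Ni; rewrite -(size_map_inj_poly (@intr_inj rat) (rmorph0 _)).
    have -> : map_poly intr q = a%:~R *: r.
      by rewrite Dr scalerA mulfV ?scale1r ?intr_eq0.
    by rewrite (leq_trans (size_scale_leq _ _)) ?size_poly.
  by rewrite zcontents_primitive nz_q dvdzE /= dvdn1 => /eqP p1; rewrite p1 in p_pr.
have nz_cont : ((zcontents q)%:~R / a%:~R : rat) != 0.
  by rewrite mulf_neq0 ?invr_eq0 ?intr_eq0 ?zcontents_eq0.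
apply: (scalerI nz_cont); rewrite scaler0 -[RHS]k_rel scaler_sumr.
apply: eq_bigr => i _; rewrite -r_i Dr coefZ coef_map [in RHS](zpolyEprim q).
rewrite coefZ nth_mktuple -/(zcontents q); move: (zcontents q) => t.
rewrite [_ * x i]mulrzl -(@scaler_int rat L) scalerA; congr (_ *: _).
by rewrite /= rmorphM; ring.
Qed.

Lemma fraction_integers x : exists y z, [/\ O y, O z, z != 0 & x = y / z].
Proof.
have [n [c [[i0 lt_i0 ndv0] rel]]] := @primitive_relation 2 (fun j => x ^+ j) isT.
pose q : {poly L} := \poly_(i < n) (c i)%:~R.
have Oq i : O q`_i.
  by rewrite coef_poly; case: ifP => _; [exact: integers_int | exact: integers0].
have nzq : q != 0.
  apply: contraNneq ndv0 => /(congr1 (coefp i0)) /=.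
  rewrite coef_poly lt_i0 coef0 => /eqP; rewrite intr_fieldExt_eq0 => /eqP ->.
  exact: dvdz0.
have qx0 : root q x by rewrite /root horner_poly rel.
exists (lead_coef q * x), (lead_coef q); split.
- exact: integers_lead_coefM.
- by rewrite lead_coefE.
- by rewrite lead_coef_eq0.
- by rewrite mulrC mulKf // lead_coef_eq0.
Qed.

End RingOfIntegers.

(** * The localization at P *)

Section Localization.

Variables (L : fieldExtType rat) (P : set L) (p : nat).
Hypotheses (P_prime : is_nonzero_prime P) (p_pr : prime p) (Pp : P p%:R).
Local Notation O := (@ring_of_integers L).

Lemma pideal_integers x : P x -> O x.
Proof. by case: P_prime => [[sPO _ _ _] _ _ _]; apply: sPO. Qed.

Lemma pideal0 : P 0.
Proof. by case: P_prime => [[]]. Qed.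

Lemma pidealD x y : P x -> P y -> P (x + y).
Proof. by case: P_prime => [[_ _ PD _] _ _ _]; apply: PD. Qed.

Lemma pidealMl x y : O x -> P y -> P (x * y).
Proof. by case: P_prime => [[_ _ _ PM] _ _ _]; apply: PM. Qed.

Lemma pidealMr x y : P x -> O y -> P (x * y).
Proof. by rewrite mulrC => Px Oy; apply: pidealMl. Qed.

Lemma pidealN x : P x -> P (- x).
Proof. by rewrite -mulN1r; apply/pidealMl/integersN/integers1. Qed.

Lemma pideal_proper : ~ P 1.
Proof. by case: P_prime. Qed.

Lemma pideal_notinM x y : O x -> O y -> ~ P x -> ~ P y -> ~ P (x * y).
Proof.
by case: P_prime => _ _ PM _ Ox Oy nPx nPy /PM-/(_ Ox Oy)[].
Qed.

Lemma bezout_residue_char (c : int) : ~~ (p%:Z %| c)%Z ->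
  exists u v : int, u%:~R * c%:~R + v%:~R * p%:R = 1 :> L.
Proof.
move=> ndv; have /coprimezP[[u v] /= uv1]: coprimez c p.
  by rewrite coprimez_sym coprimezE /= prime_coprime.
exists u, v; have := congr1 (intr : int -> L) uv1.
by rewrite rmorphD /= !rmorphM.
Qed.

Lemma pideal_notin_int (c : int) : ~~ (p%:Z %| c)%Z -> ~ P c%:~R.
Proof.
move=> /bezout_residue_char[u [v uv1]] Pc; apply: pideal_proper; move: uv1 => <-.
by apply: pidealD; apply: pidealMl => //; apply: integers_int.
Qed.

Lemma pideal_int (c : int) : (p%:Z %| c)%Z -> P c%:~R.
Proof.
move=> /dvdzP[e ->]; rewrite rmorphM; apply: pidealMl => //.
exact: integers_int.
Qed.

(** A polynomial relation for s modulo P with a coefficient prime to p can be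
    divided by s, which is not in P, until its constant term is prime to p; that
    term is then invertible modulo P and is a multiple of s. *)
Lemma pideal_maximal s : O s -> ~ P s ->
  exists a t, [/\ O a, P t & a * s + t = 1].
Proof.
move=> Os nPs; suff gen (q : {poly int}) : P (map_poly intr q).[s] ->
    (exists i, ~~ (p%:Z %| q`_i)%Z) ->
    exists a t, [/\ O a, P t & a * s + t = 1].
  case: (Os) => q qm /eqP q0; apply: (gen q); first by rewrite q0; apply: pideal0.
  exists (size q).-1; rewrite -lead_coefE (eqP qm) dvdzE /= dvdn1.
  by apply: contraTneq p_pr => ->.
elim/poly_ind: q => [_ [i] | q c IHq]; first by rewrite coef0 dvdz0.
rewrite rmorphD rmorphM /= map_polyX map_polyC !hornerE => Pqc [i ndv].
have Oq := integers_horner q Os; set y := _.[s] in Oq Pqc IHq.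
have [dvc | ndvc] := boolP (p%:Z %| c)%Z.
  apply: IHq; last first.
    exists i.-1; apply: contra ndv; rewrite coefD coefMX coefC.
    by case: i => [|i] /=; rewrite ?add0r ?addr0.
  have Pys : P (y * s).
    by rewrite -[y * s](addrK c%:~R); apply/pidealD/pidealN/pideal_int.
  by apply: contrapT => nPy; apply: (pideal_notinM Oq Os nPy nPs).
have [u [v uv1]] := bezout_residue_char ndvc.
exists (- (u%:~R * y)), (u%:~R * (y * s + c%:~R) + v%:~R * p%:R); split.
- by apply/integersN/integersM => //; apply: integers_int.
- by apply: pidealD; apply: pidealMl => //; apply: integers_int.
- by apply: etrans uv1; ring.
Qed.

Definition localized (x : L) : Prop := exists s, [/\ O s, ~ P s & O (s * x)].

Definition in_maximal (x : L) : Prop := exists s, [/\ O s, ~ P s & P (s * x)].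

Lemma localized_integers x : O x -> localized x.
Proof.
by exists 1; rewrite mul1r; split=> //; [exact: integers1 | exact: pideal_proper].
Qed.

Lemma localizedM x y : localized x -> localized y -> localized (x * y).
Proof.
move=> [s [Os nPs Osx]] [t [Ot nPt Oty]]; exists (s * t); split.
- exact: integersM.
- exact: pideal_notinM.
- by rewrite mulrACA; apply: integersM.
Qed.

Lemma localizedD x y : localized x -> localized y -> localized (x + y).
Proof.
move=> [s [Os nPs Osx]] [t [Ot nPt Oty]]; exists (s * t); split.
- exact: integersM.
- exact: pideal_notinM.
- rewrite mulrDr -mulrA mulrCA -mulrA.
  by apply: integersD; apply: integersM.
Qed.

Lemma localized0 : localized 0.
Proof. exact/localized_integers/integers0. Qed.

Lemma localized1 : localized 1.
Proof. exact/localized_integers/integers1. Qed.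

Lemma localizedX x n : localized x -> localized (x ^+ n).
Proof.
move=> Vx; elim: n => [|n IHn]; first exact: localized1.
by rewrite exprS; apply: localizedM.
Qed.

Lemma localized_cancel s x : O s -> ~ P s -> localized (s * x) -> localized x.
Proof.
move=> Os nPs [t [Ot nPt Otsx]]; exists (t * s); rewrite -mulrA; split=> //.
- exact: integersM.
- exact: pideal_notinM.
Qed.

Lemma in_maximal_localized x : in_maximal x -> localized x.
Proof. by move=> [s [Os nPs /pideal_integers Osx]]; exists s. Qed.

Lemma in_maximal_or_unit x : localized x -> in_maximal x \/ localized x^-1.
Proof.
move=> [s [Os nPs Osx]]; have [Psx | nPsx] := pselect (P (s * x)).
  by left; exists s.
have [-> | nzx] := eqVneq x 0; first by right; rewrite invr0; apply: localized0.
by right; exists (s * x); rewrite mulfK.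
Qed.

Lemma in_maximal_nunit x : x != 0 -> in_maximal x -> ~ localized x^-1.
Proof.
move=> nzx [s [Os nPs Psx]] [t [Ot nPt Otx]]; apply: (pideal_notinM Os Ot nPs nPt).
by have := pidealMr Psx Otx; rewrite mulrACA mulfV ?mulr1.
Qed.

Lemma residue_char_neq0 : (p%:R : L) != 0.
Proof. by rewrite -[p%:R]/(p%:~R) intr_fieldExt_eq0; case: (p) p_pr. Qed.

(** In the localization at P, the class of b modulo p is a nonzero element killed
    by P.  Otherwise there would be an infinite chain of products b i of elements
    of P, each one dividing the next, none of them zero modulo p locally at P.  In
    a relation between the b i, let i be the least index with a coefficient prime
    to p: all later terms are in b i P, so a unit of the localization times b i is
    divisible by p. *)
Lemma pideal_socle :
  exists b, [/\ O b, ~ localized (b / p%:R)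
              & forall t, P t -> localized (b * t / p%:R)].
Proof.
apply: contrapT => nosocle; have nzp := residue_char_neq0.
have step b : exists t, O b -> ~ localized (b / p%:R) ->
    P t /\ ~ localized (b * t / p%:R).
  apply: contrapT => nostep; apply: nosocle; exists b.
  have [Ob | nOb] := pselect (O b); last by case: nostep; exists 0 => /nOb.
  have [Zb | nZb] := pselect (localized (b / p%:R)).
    by case: nostep; exists 0 => _ /(_ Zb).
  split=> // t Pt; apply: contrapT => nZbt; apply: nostep; by exists t.
have [tau tauP] := choice step.
pose b := fix b i := if i is j.+1 then b j * tau (b j) else 1.
have bP i : O (b i) /\ ~ localized (b i / p%:R).
  elim: i => [|i [Ob nZb]] /=.
    split=> [|[s [Os nPs Osp]]]; first exact: integers1.
    apply: nPs; rewrite -[s](divfK nzp); apply: pidealMl => //.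
    by rewrite mul1r in Osp.
  have [Pt nZbt] := tauP _ Ob nZb; split=> //.
  by apply: integersM => //; apply: pideal_integers.
have b_mul i j : exists2 y, P y & b (i + j.+1)%N = b i * y.
  elim: j => [|j [y Py Dy]].
    rewrite addn1 /=; exists (tau (b i)) => //.
    by case: (bP i) => Ob nZb; case: (tauP _ Ob nZb).
  rewrite addnS /= Dy -mulrA; eexists; last by [].
  rewrite -Dy; apply: pidealMr => //; case: (bP (i + j.+1)%N) => Ob nZb.
  by case: (tauP _ Ob nZb) => /pideal_integers.
have [n [c [[i0 lt_i0 ndv0] rel]]] := primitive_relation b p_pr.
have ex_i : exists i, (i < n)%N && ~~ (p%:Z %| c i)%Z by exists i0; rewrite lt_i0.
case: (ex_minnP ex_i) => i /andP[lt_in ndv] min_i.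
have [x [y [Ox Py Dxy]]] : exists x y, [/\ O x, P y &
    \sum_(j < n | j != Ordinal lt_in) (c j)%:~R * b j = p%:R * x + b i * y].
  pose K z := exists x y, [/\ O x, P y & z = p%:R * x + b i * y].
  apply: (big_ind K) => [|z1 z2 [x1 [y1 [Ox1 Py1 ->]]] [x2 [y2 [Ox2 Py2 ->]]]|j].
  - exists 0, 0; rewrite !mulr0 addr0.
    by split=> //; [exact: integers0 | exact: pideal0].
  - exists (x1 + x2), (y1 + y2); split; [exact: integersD | exact: pidealD | by ring].
  rewrite -val_eqE neq_ltn /= => /orP[lt_ji | lt_ij].
    have: (p%:Z %| c j)%Z.
      apply: contraLR lt_ji => ndvj; rewrite -leqNgt; apply: min_i.
      by rewrite ndvj ltn_ord.
    move=> /dvdzP[e ->]; exists (e%:~R * b j), 0.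
    split; last by rewrite rmorphM /=; ring.
      by apply: integersM; [exact: integers_int | case: (bP j)].
    exact: pideal0.
  have [y Py Dj] := b_mul i (j - i.+1)%N; rewrite addnS -addSn subnKC // in Dj.
  exists 0, ((c j)%:~R * y); split; [exact: integers0 | | by rewrite Dj; ring].
  by apply: pidealMl => //; apply: integers_int.
move: rel; rewrite (bigD1 (Ordinal lt_in)) //= Dxy => rel.
have [Obi nZbi] := bP i; apply: nZbi.
apply: (@localized_cancel ((c i)%:~R + y)).
- by apply: integersD; [exact: integers_int | exact: pideal_integers].
- move=> Pcy; apply: (pideal_notin_int ndv); rewrite -[_%:~R](addrK y).
  exact/pidealD/pidealN.
- apply: localized_integers.
  have -> : ((c i)%:~R + y) * (b i / p%:R) = - x.
    apply: (mulIf nzp); rewrite mulrA divfK //; apply/eqP; rewrite -subr_eq0.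
    by apply/eqP; apply: etrans rel; ring.
  exact: integersN.
Qed.

(** In a relation between the powers of g, let i be the greatest index with a
    coefficient prime to p.  The higher terms lie in the localization because p is
    a common denominator of the powers of g, so that the relation is an equation
    of integral dependence for g whose leading coefficient is not in P. *)
Lemma almost_integral_char g :
  (forall j, localized (p%:R * g ^+ j)) -> localized g.
Proof.
move=> Vpg.
(* Starting at the first power keeps the degree i + 1 of the equation positive. *)
have [n [c [[i0 lt_i0 ndv0] rel]]] := primitive_relation (fun j => g ^+ j.+1) p_pr.
have ex_i : exists i, (i < n)%N && ~~ (p%:Z %| c i)%Z by exists i0; rewrite lt_i0.
have ub_i i : (i < n)%N && ~~ (p%:Z %| c i)%Z -> (i <= n)%N.
  by case/andP => /ltnW.
case: (ex_maxnP ex_i ub_i) => i /andP[lt_in ndv] max_i.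
pose h := \sum_(j < n | (i < j)%N) (c j)%:~R * g ^+ j.+1.
have [s [Os nPs Osh]] : localized h.
  apply: big_ind => [|x y|j lt_ij]; [exact: localized0 | exact: localizedD | ].
  have: (p%:Z %| c j)%Z.
    by apply: contraLR lt_ij => ndvj; rewrite -leqNgt max_i // ltn_ord.
  move=> /dvdzP[e ->]; rewrite rmorphM -mulrA; apply: localizedM => //.
  exact/localized_integers/integers_int.
pose f j := if j is j'.+1 then s * (c j')%:~R else s * h.
pose q := \poly_(j < i.+2) f j.
have nzs : s != 0 by apply: contra_not_neq nPs => ->; apply: pideal0.
have nzc : ((c i)%:~R : L) != 0.
  by apply: contra_not_neq (pideal_notin_int ndv) => ->; apply: pideal0.
have lead_q : lead_coef q = s * (c i)%:~R by rewrite lead_coef_poly ?mulf_neq0.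
have Oq j : O q`_j.
  rewrite coef_poly; case: ifP => _; last exact: integers0.
  by case: j => [//|j]; apply: integersM => //; apply: integers_int.
have /(integers_lead_coefM Oq) : root q g.
  rewrite /root horner_poly big_ord_recl /= expr0 mulr1.
  rewrite -[X in _ == X](mulr0 s) -[in X in _ == X]rel.
  rewrite (bigID (fun j : 'I_n => (i < j)%N)) /= -/h mulrDr; apply/eqP; congr (_ + _).
  rewrite mulr_sumr.
  rewrite (big_ord_widen_cond _ xpredT (fun j => s * (c j)%:~R * g ^+ j.+1) lt_in).
  by apply: eq_big => j; rewrite /= ?ltnS -?leqNgt // mulrA.
rewrite lead_q; exists (s * (c i)%:~R); split=> //.
  by apply: integersM => //; apply: integers_int.
by apply: pideal_notinM => //; [exact: integers_int | exact: pideal_notin_int].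
Qed.

(** Up to sign, x y is the lowest nonzero coefficient of a monic equation of x; the
    part of this integer that is prime to p is the factor t outside P. *)
Lemma integers_divide_char_power x : O x -> x != 0 ->
  exists y s t, [/\ O y, O t, ~ P t & x * y = p%:R ^+ s * t].
Proof.
move=> Ox nzx; have [y [m [Oy nzm xy]]] : exists y (m : int),
    [/\ O y, m != 0 & x * y = m%:~R].
  have [q qm /eqP] := Ox; have := monic_neq0 qm.
  elim/poly_ind: q {qm} => [|q c IHq]; first by rewrite eqxx.
  rewrite rmorphD rmorphM /= map_polyX map_polyC !hornerE => nzqc qc0.
  have [c0 | nzc] := eqVneq c 0.
    apply: IHq; first by apply: contraNneq nzqc => ->; rewrite c0 mul0r addr0.
    by apply/eqP; move/eqP: qc0; rewrite c0 addr0 mulf_eq0 (negPf nzx) orbF.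
  exists (- (map_poly intr q).[x]), c; split=> //.
    by apply/integersN/integers_horner.
  by apply/eqP; rewrite -subr_eq0 -oppr_eq0; apply/eqP; apply: etrans qc0; ring.
have m_gt0 : (0 < `|m|)%N by rewrite absz_gt0.
have [n ndvn] := pfactor_coprime p_pr m_gt0; move: (logn p _) => s Dm.
exists y, s, (((-1) ^+ (m < 0)%R * n%:Z)%:~R); split=> //.
- exact: integers_int.
- apply: pideal_notin_int; rewrite dvdzE abszMsign /=.
  by rewrite -prime_coprime.
- rewrite xy [in LHS](intEsign m) Dm PoszM.
  by rewrite !rmorphM /= -!pmulrn natrX; ring.
Qed.

(** The common denominator can be taken to be a power of p, and the exponent can
    be lowered from s + 1 to s: p is a common denominator of the powers of
    h = p^s g^j, because p h^i = p^(s (i - 1)) (p^(s + 1) g^(j i)) if i > 0, so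
    that h is integral at P by [almost_integral_char]. *)
Lemma almost_integral x g : O x -> x != 0 ->
  (forall j, localized (x * g ^+ j)) -> localized g.
Proof.
move=> Ox nzx Vxg; have [y [s [t [Oy Ot nPt xy]]]] := integers_divide_char_power Ox nzx.
have: forall j, localized (p%:R ^+ s * g ^+ j).
  move=> j; apply: (localized_cancel Ot nPt).
  have -> : t * (p%:R ^+ s * g ^+ j) = y * (x * g ^+ j).
    by rewrite !mulrA [t * _]mulrC -xy [x * y]mulrC.
  by apply: localizedM => //; apply: localized_integers.
have Vp i : localized (p%:R ^+ i).
  exact/localized_integers/integersX/integers_nat.
elim: s {xy} => [/(_ 1%N) | s IHs Vpg]; first by rewrite mul1r.
have [/IHs //|/existsNP[j0 nVd]] := pselect (forall j, localized (p%:R ^+ s * g ^+ j)).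
case: nVd; apply: almost_integral_char => -[|j].
  by rewrite expr0 mulr1; apply: (Vp 1%N).
have -> : p%:R * (p%:R ^+ s * g ^+ j0) ^+ j.+1
          = p%:R ^+ (s * j) * (p%:R ^+ s.+1 * g ^+ (j0 * j.+1)) :> L.
  by rewrite exprMn -!exprM mulnS exprD exprS; ring.
exact: localizedM.
Qed.

(** With b as in [pideal_socle], multiplication by g = b / p maps P into the
    localization.  It does not map P into the maximal ideal, for p g^j would then
    be integral at P for all j, and so would g.  So some pi in P has g pi a unit,
    and x / pi = g x / (g pi). *)
Lemma uniformizer_exists :
  exists pi, [/\ P pi, pi != 0 & forall x, in_maximal x -> localized (x / pi)].
Proof.
have nzp := residue_char_neq0; have [b [Ob nVb Vbt]] := pideal_socle.
pose g := b / p%:R; have Vgt t : P t -> localized (g * t).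
  by move=> Pt; rewrite /g mulrAC; apply: Vbt.
have [pi Ppi nMgpi] : exists2 pi, P pi & ~ in_maximal (g * pi).
  apply: contrapT => nopi; apply: nVb; apply: almost_integral_char => j.
  apply: in_maximal_localized; elim: j => [|j [s [Os nPs Psx]]].
    exists 1; rewrite mulr1 mul1r.
    by split=> //; [exact: integers1 | exact: pideal_proper].
  have [s' [Os' nPs' Psgx]] : in_maximal (g * (s * (p%:R * g ^+ j))).
    by apply: contrapT => nM; apply: nopi; eexists; eauto.
  exists (s' * s); split; [exact: integersM | exact: pideal_notinM | ].
  by move: Psgx; congr P; rewrite exprS -/g; ring.
have [//|Vu] := in_maximal_or_unit (Vgt _ Ppi).
have nzgpi : g * pi != 0.
  apply: contra_not_neq nMgpi => ->; exists 1; rewrite mulr0.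
  by split; [exact: integers1 | exact: pideal_proper | exact: pideal0].
have nzpi : pi != 0 by apply: contraNneq nzgpi => ->; rewrite mulr0.
exists pi; split=> // x [s [Os nPs Psx]]; apply: (localized_cancel Os nPs).
have -> : s * (x / pi) = (g * (s * x)) * (g * pi)^-1.
  apply: (mulIf nzpi); apply: (mulIf nzgpi).
  by rewrite [in RHS]mulrAC divfK // mulrA divfK //; ring.
by apply: localizedM => //; apply: Vgt.
Qed.

(** * Powers of P and valuations *)

Lemma ideal_mulP (I J : set L) x y : I x -> J y -> ideal_mul I J (x * y).
Proof.
move=> Ix Jy; exists [:: (x, y)]; last by rewrite big_seq1.
by move=> u; rewrite inE => /eqP ->.
Qed.

Lemma ideal_mulD (I J : set L) x y :
  ideal_mul I J x -> ideal_mul I J y -> ideal_mul I J (x + y).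
Proof.
move=> [r IJr ->] [s IJs ->]; exists (r ++ s); last by rewrite big_cat.
by move=> u; rewrite mem_cat => /orP[/IJr | /IJs].
Qed.

Lemma ideal_exp_integersM e x y :
  O x -> ideal_exp P e y -> ideal_exp P e (x * y).
Proof.
move=> Ox; case: e => [|e]; first exact: integersM.
move=> [s IJs ->]; exists [seq (x * u.1, u.2) | u <- s].
  by move=> _ /mapP[u /IJs[Pu Pu'] ->]; split=> //; apply: pidealMl.
by rewrite big_map mulr_sumr; apply: eq_bigr => u _; rewrite mulrA.
Qed.

Lemma ideal_expD e x y :
  ideal_exp P e x -> ideal_exp P e y -> ideal_exp P e (x + y).
Proof. by case: e => [|e]; [exact: integersD | exact: ideal_mulD]. Qed.

Lemma ideal_expX t e : P t -> ideal_exp P e (t ^+ e).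
Proof.
move=> Pt; elim: e => [|e IHe]; first exact: integers1.
by rewrite exprS; apply: ideal_mulP.
Qed.

(** By maximality s is invertible modulo P, hence modulo P^e. *)
Lemma ideal_exp_primary e s y :
  O s -> ~ P s -> O y -> ideal_exp P e (s * y) -> ideal_exp P e y.
Proof.
move=> Os nPs Oy Psy; have [a [t [Oa Pt ast1]]] := pideal_maximal Os nPs.
have [a' Oa' Da'] : exists2 a', O a' & a' * s + t ^+ e = 1.
  elim: e {Psy} => [|e [a' Oa' IHe]].
    by exists 0; [exact: integers0 | rewrite mul0r add0r].
  exists (a * (a' * s + t ^+ e) + a' * t).
    rewrite IHe mulr1; apply: integersD => //; apply: integersM => //.
    exact: pideal_integers.
  rewrite -[RHS](mulr1 1) -{1}ast1 -IHe exprS; ring.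
have -> : y = a' * (s * y) + y * t ^+ e.
  by rewrite mulrA [y * _]mulrC -mulrDl Da' mul1r.
by apply: ideal_expD; apply: ideal_exp_integersM => //; apply: ideal_expX.
Qed.

Section Uniformizer.

Variable pi : L.
Hypotheses (Ppi : P pi) (nzpi : pi != 0).
Hypothesis pi_gen : forall x, in_maximal x -> localized (x / pi).

(** For a generator pi of the maximal ideal this is the condition that x has order
    at least e, phrased so that it also makes sense for x = 0. *)
Definition ord_ge (e : int) (x : L) : Prop := localized (x * pi ^ (- e)).

Definition has_ord (e : int) (x : L) : Prop := ord_ge e x /\ ~ ord_ge (e + 1) x.

Lemma ord_ge0 e : ord_ge e 0.
Proof. by rewrite /ord_ge mul0r; apply: localized0. Qed.

Lemma ord_geD e x y : ord_ge e x -> ord_ge e y -> ord_ge e (x + y).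
Proof. by rewrite /ord_ge mulrDl; apply: localizedD. Qed.

Lemma ord_geM e f x y : ord_ge e x -> ord_ge f y -> ord_ge (e + f) (x * y).
Proof.
rewrite /ord_ge opprD (expfzDr _ _ nzpi) mulrACA; exact: localizedM.
Qed.

Lemma ord_ge_le e f x : f <= e -> ord_ge e x -> ord_ge f x.
Proof.
move=> le_fe xe; rewrite /ord_ge (_ : - f = - e + (e - f)); last by ring.
rewrite (expfzDr _ _ nzpi) mulrA; apply: localizedM => //.
case: (e - f) (subr_ge0 f e) => // [n _|n]; last by rewrite le_fe.
exact/localizedX/localized_integers/pideal_integers.
Qed.

Lemma has_ord_unit e x : has_ord e x -> x != 0 /\ ord_ge (- e) x^-1.
Proof.
move=> [xe nxe]; have nzx: x != 0.
  by apply: contra_not_neq nxe => ->; apply: ord_ge0.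
split=> //; have [/pi_gen Vx | ] := in_maximal_or_unit xe.
  by case: nxe; rewrite /ord_ge opprD (expfzDr _ _ nzpi) mulrA.
by rewrite invfM /ord_ge invr_expz.
Qed.

Lemma has_ordM e f x y : has_ord e x -> has_ord f y -> has_ord (e + f) (x * y).
Proof.
move=> [xe nxe] yf; have [nzy y'f] := has_ord_unit yf; split.
  by apply: ord_geM => //; case: yf.
move=> /ord_geM-/(_ _ _ y'f); rewrite mulfK // => xe1; apply: nxe.
by move: xe1; congr ord_ge; ring.
Qed.

Lemma has_ordV e x : has_ord e x -> has_ord (- e) x^-1.
Proof.
move=> xe; have [nzx x'e] := has_ord_unit xe; split=> // x'e1.
case: xe => xe _; have := ord_geM xe x'e1; rewrite mulfV //.
rewrite (_ : e + _ = 1); last by ring.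
rewrite /ord_ge mul1r -invr_expz expr1z.
apply: in_maximal_nunit => //; exists 1; rewrite mul1r.
by split; [exact: integers1 | exact: pideal_proper |].
Qed.

Lemma has_ord_uniq e f x : has_ord e x -> has_ord f x -> e = f.
Proof.
wlog lt_ef : e f / e < f.
  move=> gen xe xf; case: (ltgtP e f) => // [lt_ef | lt_fe]; first exact: gen.
  by apply/esym/gen.
by move=> [_ nxe] [xf _]; case: nxe; apply: ord_ge_le xf; rewrite lezD1.
Qed.

Lemma has_ord_ge e f x : has_ord e x -> ord_ge f x <-> f <= e.
Proof.
move=> xe; split=> [xf | le_fe]; last by apply: ord_ge_le le_fe _; case: xe.
rewrite leNgt; apply/negP => lt_ef; case: xe => _; case.
by apply: ord_ge_le xf; rewrite lezD1.
Qed.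

(** If x were divisible by all powers of pi, then x would be a common denominator
    of the powers of 1 / pi, which is not integral at P. *)
Lemma integers_has_ord x : O x -> x != 0 -> exists e : nat, has_ord e x.
Proof.
move=> Ox nzx; have piM : in_maximal pi.
  by exists 1; rewrite mul1r; split=> //; [exact: integers1 | exact: pideal_proper].
have /existsNP[e0 nxe0] : ~ forall e : nat, ord_ge e x.
  move=> xe; apply: (in_maximal_nunit nzpi piM).
  apply: (almost_integral Ox nzx) => e.
  by have := xe e; rewrite /ord_ge -invr_expz exprVn.
have ex_e : exists e : nat, `[< ~ ord_ge e x >] by exists e0; apply/asboolP.
case: (ex_minnP ex_e) => -[|e] /asboolP nxe min_e.
  by case: nxe; rewrite /ord_ge oppr0 expr0z mulr1; apply: localized_integers.
exists e; split; last by rewrite addrC -intS.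
by apply: contrapT => /asboolP/min_e; rewrite ltnn.
Qed.

(** This is what makes exact powers of the ideal P multiplicative: P^e is the
    trace on the integers of the e-th power of the maximal ideal. *)
Lemma ideal_expE e y : ideal_exp P e y <-> O y /\ ord_ge e y.
Proof.
split=> [|[Oy [s [Os nPs Osy]]]]; last first.
  apply: (ideal_exp_primary Os nPs Oy).
  rewrite (_ : s * y = s * (y * pi ^ (- e%:Z)) * pi ^+ e).
    by apply: ideal_exp_integersM => //; apply: ideal_expX.
  by rewrite -mulrA -invr_expz mulfVK // expf_neq0.
elim: e y => [|e IHe] y.
  move=> Oy; split=> //; rewrite /ord_ge oppr0 expr0z mulr1.
  exact: localized_integers.
move=> [s IJs ->]; rewrite big_seq.
pose K z := O z /\ ord_ge e.+1 z; apply: (big_ind K).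
- by split; [exact: integers0 | exact: ord_ge0].
- by move=> u w [Ou ue] [Ow we]; split; [exact: integersD | exact: ord_geD].
move=> u /IJs[Pu /IHe[Ou' u'e]]; have Ou := pideal_integers Pu; split.
  exact: integersM.
rewrite intS; apply: ord_geM => //; rewrite /ord_ge -invr_expz.
apply: pi_gen; exists 1; rewrite mul1r.
by split=> //; [exact: integers1 | exact: pideal_proper].
Qed.

Lemma exact_powerE e y : exact_power P y e <-> O y /\ has_ord e y.
Proof.
rewrite /exact_power !ideal_expE /has_ord addrC -intS.
split=> [[[Oy ye] nye] | [Oy [ye nye]]]; do !split=> //.
  by move=> ye1; apply: nye.
by case.
Qed.

Lemma valuation_has_ord x : x != 0 -> has_ord (valuation P x) x.
Proof.
move=> nzx; rewrite /valuation.
set S := (S in xget 0 S); have: S (xget 0 S).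
  apply: xgetPex; have [y [z [Oy Oz nzz Dx]]] := fraction_integers x.
  have nzy : y != 0 by apply: contraNneq nzx => y0; rewrite Dx y0 mul0r.
  have [e ye] := integers_has_ord Oy nzy; have [f zf] := integers_has_ord Oz nzz.
  by exists (e%:Z - f%:Z), y, z, e, f; split=> //; split; apply/exact_powerE.
move=> [y [z [e [f [_ _ Dx [/exact_powerE[_ ye] /exact_powerE[_ zf]] ->]]]]].
by rewrite Dx; apply: has_ordM => //; apply: has_ordV.
Qed.

End Uniformizer.

Lemma valuationM x y : x != 0 -> y != 0 ->
  valuation P (x * y) = valuation P x + valuation P y.
Proof.
have [pi [Ppi nzpi pi_gen]] := uniformizer_exists; move=> nzx nzy.
have nzxy : x * y != 0 by rewrite mulf_neq0.
have v := @valuation_has_ord pi Ppi nzpi pi_gen.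
by apply: (has_ord_uniq Ppi nzpi (v _ nzxy)); apply: has_ordM => //; apply: v.
Qed.

Lemma valuationD_ge x y e : x + y != 0 ->
  (x != 0 -> e <= valuation P x) -> (y != 0 -> e <= valuation P y) ->
  e <= valuation P (x + y).
Proof.
have [pi [Ppi nzpi pi_gen]] := uniformizer_exists; move=> nzxy xe ye.
have v := @valuation_has_ord pi Ppi nzpi pi_gen.
apply/(has_ord_ge Ppi nzpi _ (v _ nzxy)); apply: ord_geD.
  have [->|nzx] := eqVneq x 0; first exact: ord_ge0.
  by apply/(has_ord_ge Ppi nzpi _ (v _ nzx)); apply: xe.
have [->|nzy] := eqVneq y 0; first exact: ord_ge0.
by apply/(has_ord_ge Ppi nzpi _ (v _ nzy)); apply: ye.
Qed.

Lemma valuation_pideal_gt0 x : P x -> x != 0 -> 0 < valuation P x.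
Proof.
have [pi [Ppi nzpi pi_gen]] := uniformizer_exists; move=> Px nzx.
have v := @valuation_has_ord pi Ppi nzpi pi_gen.
rewrite gtz0_ge1; apply/(has_ord_ge Ppi nzpi _ (v _ nzx)).
rewrite /ord_ge -invr_expz; apply: pi_gen; exists 1; rewrite mul1r.
by split; [exact: integers1 | exact: pideal_proper |].
Qed.

Lemma valuation_unit x : O x -> ~ P x -> valuation P x = 0.
Proof.
have [pi [Ppi nzpi pi_gen]] := uniformizer_exists; move=> Ox nPx.
have nzx : x != 0 by apply: contra_not_neq nPx => ->; apply: pideal0.
have v := @valuation_has_ord pi Ppi nzpi pi_gen.
apply: (has_ord_uniq Ppi nzpi (v _ nzx)); split.
  by rewrite /ord_ge oppr0 expr0z mulr1; apply: localized_integers.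
rewrite add0r /ord_ge -invr_expz expr1z => -[s [Os nPs Osx]].
apply: (pideal_notinM Os Ox nPs nPx); have := pidealMr Ppi Osx.
by rewrite mulrCA [pi * _]mulrC divfK.
Qed.

End Localization.

(** * Discrete valuations on a field *)

Section ValuedField.

Variables (K : fieldType) (v : K -> int).
Hypothesis vM : forall x y, x != 0 -> y != 0 -> v (x * y) = v x + v y.
Hypothesis vD : forall x y e, x + y != 0 ->
  (x != 0 -> e <= v x) -> (y != 0 -> e <= v y) -> e <= v (x + y).

(** The value of v at 0 carries no information, whence the restriction to x != 0. *)
Definition val_ge (e : int) (x : K) : Prop := x != 0 -> e <= v x.

Lemma val_1 : v 1 = 0.
Proof. by apply: (addIr (v 1)); rewrite add0r -vM ?oner_neq0 // mulr1. Qed.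

Lemma val_N x : v (- x) = v x.
Proof.
have [-> | nzx] := eqVneq x 0; first by rewrite oppr0.
have nzN1 : (-1 : K) != 0 by rewrite oppr_eq0 oner_neq0.
have := vM nzN1 nzN1; rewrite mulrNN mulr1 val_1 => v2.
by rewrite -[- x]mulN1r vM // (_ : v (-1) = 0) ?add0r //; lia.
Qed.

Lemma val_V x : x != 0 -> v x^-1 = - v x.
Proof.
move=> nzx; have := vM nzx; move=> /(_ x^-1); rewrite invr_eq0 mulfV // val_1.
by move=> /(_ nzx); lia.
Qed.

Lemma val_X x n : x != 0 -> v (x ^+ n) = n%:Z * v x.
Proof.
move=> nzx; elim: n => [|n IHn]; first by rewrite expr0 val_1 mul0r.
by rewrite exprS vM ?expf_neq0 // IHn intS mulrDl mul1r.
Qed.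

Lemma val_ge_le e f x : f <= e -> val_ge e x -> val_ge f x.
Proof. by move=> le_fe xe nzx; apply: le_trans le_fe (xe nzx). Qed.

Lemma val_ge0 e : val_ge e 0.
Proof. by rewrite /val_ge eqxx. Qed.

Lemma val_geN e x : val_ge e x -> val_ge e (- x).
Proof. by rewrite /val_ge oppr_eq0 val_N. Qed.

Lemma val_geD e x y : val_ge e x -> val_ge e y -> val_ge e (x + y).
Proof. by move=> xe ye nzxy; apply: vD. Qed.

Lemma val_geM e f x y : val_ge e x -> val_ge f y -> val_ge (e + f) (x * y).
Proof.
move=> xe yf; rewrite /val_ge mulf_eq0 negb_or => /andP[nzx nzy].
by rewrite vM // lerD // ?xe ?yf.
Qed.

Lemma val_geX e x n : val_ge e x -> val_ge (n%:Z * e) (x ^+ n).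
Proof.
move=> xe; elim: n => [|n IHn]; first by rewrite mul0r expr0 /val_ge val_1.
by rewrite exprS intS mulrDl mul1r; apply: val_geM.
Qed.

Lemma val_ge_sum e (I : Type) (s : seq I) (Q : pred I) (E : I -> K) :
  (forall i, Q i -> val_ge e (E i)) -> val_ge e (\sum_(i <- s | Q i) E i).
Proof.
by move=> Ee; apply: big_ind => //; [exact: val_ge0 | exact: val_geD].
Qed.

Lemma val_dominant x y : x != 0 -> val_ge (v x + 1) y ->
  x + y != 0 /\ v (x + y) = v x.
Proof.
move=> nzx yx1; have nzxy : x + y != 0.
  rewrite addr_eq0; apply/eqP => Dx.
  have nzy : y != 0 by apply: contraNneq nzx => y0; rewrite Dx y0 oppr0.
  by have := yx1 nzy; rewrite Dx val_N; lia.
split=> //; apply/eqP; rewrite eq_le andbC vD //=; last first.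
  by move=> /yx1; lia.
rewrite leNgt; apply/negP => lt_x; have: val_ge (v x + 1) (x + y - y).
  by apply: val_geD (val_geN yx1) => _; lia.
by rewrite addrK => /(_ nzx); lia.
Qed.

(** * Periodic points of sparse polynomials *)

Section Dynamics.

Variables (d k : nat) (b : nat -> K) (a c : K).

(** The exponents d - i, for i at most k, are those of the Belyi polynomial; the
    coefficients are arbitrary, since only their valuations matter. *)
Definition sparse_poly (z : K) : K := \sum_(i < k.+1) b i * z ^+ (d - i).

Definition scaled_map (z : K) : K := a * sparse_poly z + c.

Hypothesis lt_kd : (k.+1 < d)%N.

Lemma scaled_map0 : scaled_map 0 = c.
Proof.
rewrite /scaled_map /sparse_poly big1 ?mulr0 ?add0r // => -[i /= lt_ik] _.
by rewrite expr0n (_ : (d - i == 0)%N = false) ?mulr0 //; lia.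
Qed.

(** The hypothesis says that on the disc of level T no term of a B(z) leaves the
    disc.  Since x^j - y^j is x - y times a form of degree j - 1 in x and y, it
    also bounds the factor by which each term stretches distances. *)
Lemma scaled_map_nonexpanding (T e : int) x y :
  (forall i, (i <= k)%N -> T <= v a + v (b i) + (d - i)%:Z * T) ->
  val_ge T c -> val_ge T x -> val_ge T y -> val_ge e (x - y) ->
  val_ge T (scaled_map x) /\ val_ge e (scaled_map x - scaled_map y).
Proof.
move=> keep cT xT yT xye; split.
  apply: val_geD cT; rewrite mulr_sumr; apply: val_ge_sum => i _.
  have le_ik : (i <= k)%N by rewrite -ltnS.
  apply: val_ge_le (keep i le_ik) _; rewrite -addrA; apply: val_geM => //.
  by apply: val_geM => //; apply: val_geX.
rewrite /scaled_map opprD addrACA addrN addr0 -mulrBr -sumrB mulr_sumr.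
apply: val_ge_sum => i _; have le_ik : (i <= k)%N by rewrite -ltnS.
rewrite -mulrBr subrXX [(x - y) * _]mulrC !mulrA -[e]add0r; apply: val_geM => //.
have [j Dj] : exists j, (d - i)%N = j.+1 by exists (d - i).-1; lia.
have {keep} := keep i le_ik; rewrite Dj => keep.
apply: (@val_ge_le (v a + v (b i) + j%:Z * T)); first by lia.
apply: val_geM; first exact: val_geM.
apply: val_ge_sum => -[l /= le_lj] _.
rewrite (_ : j%:Z * T = (j.+1.-1 - l)%:Z * T + l%:Z * T).
  by apply: val_geM; apply: val_geX.
by rewrite -mulrDl; congr (_ * _); lia.
Qed.

Variables (r : nat) (w : int).
Hypotheses (le_rk : (r <= k)%N) (nzb : forall i, (i <= k)%N -> b i != 0).
Hypotheses (vbr : v (b r) = 0) (w_gt0 : 0 < w).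
Hypothesis vb : forall i, (i <= k)%N -> i != r -> v (b i) = w.

(** The term of index r is the only one that is a unit. *)
Lemma val_sparse_poly1 : sparse_poly 1 != 0 /\ v (sparse_poly 1) = 0.
Proof.
rewrite /sparse_poly (bigD1 (Ordinal (le_rk : (r < k.+1)%N))) //= expr1n mulr1 -vbr.
apply: val_dominant; first exact: nzb.
apply: val_ge_sum => -[i lt_ik]; rewrite -val_eqE /= => ne_ir _.
by rewrite expr1n mulr1 vbr vb //; lia.
Qed.

Lemma val_term i z : (i <= k)%N -> z != 0 ->
  v (b i * z ^+ (d - i)) = v (b i) + (d - i)%:Z * v z.
Proof. by move=> le_ik nzz; rewrite vM ?nzb ?expf_neq0 // val_X. Qed.

Hypothesis ndv_w : ~~ (r%:Z %| w)%Z.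

(** The terms other than the one of index r have coefficients of the same
    valuation, so that z^d is the least of them; it ties with z^(d - r) only if
    w = - r v(z). *)
Lemma val_sparse_poly z : z != 0 -> v z < 0 ->
  sparse_poly z != 0
  /\ forall i, (i <= k)%N -> v (sparse_poly z) <= v (b i) + (d - i)%:Z * v z.
Proof.
move=> nzz lt_z0.
have [i0 le_i0k dom] : exists2 i0, (i0 <= k)%N & forall i, (i <= k)%N -> i != i0 ->
    v (b i0) + (d - i0)%:Z * v z + 1 <= v (b i) + (d - i)%:Z * v z.
  have Dexp i : (i <= k)%N -> (d - i)%:Z * v z = d%:Z * v z - i%:Z * v z.
    by move=> le_ik; rewrite -mulrBl; congr (_ * _); lia.
  have le_iz (i : nat) : i%:Z * v z <= 0 by nia.
  have lt_iz (i : nat) : i != 0 -> i%:Z * v z < 0 by nia.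
  case: (ltgtP (w + r%:Z * v z) 0) => [lt_w | gt_w | eq_w].
  - have nzr : r != 0 by apply: contraTneq lt_w => ->; rewrite mul0r; lia.
    exists 0 => // i le_ik nzi; rewrite !Dexp // mul0r.
    rewrite (vb (i := 0)) //; last by rewrite eq_sym.
    have [-> | ne_ir] := eqVneq i r; first by rewrite vbr; lia.
    by rewrite vb //; have := lt_iz i nzi; lia.
  - exists r => // i le_ik ne_ir; rewrite !Dexp // vbr vb //.
    by have := le_iz i; lia.
  - case/negP: ndv_w; apply/dvdzP; exists (- v z); lia.
have nzt : b i0 * z ^+ (d - i0) != 0 by rewrite mulf_neq0 ?nzb ?expf_neq0.
rewrite /sparse_poly (bigD1 (Ordinal (le_i0k : (i0 < k.+1)%N))) //=.
set rest := \sum_(i < _ | _) _.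
have [nz ->] : b i0 * z ^+ (d - i0) + rest != 0
    /\ v (b i0 * z ^+ (d - i0) + rest) = v (b i0 * z ^+ (d - i0)).
  apply: val_dominant => //; apply: val_ge_sum => -[i /= lt_ik].
  by rewrite -val_eqE /= => ne_i _; rewrite !val_term // dom.
split=> // i le_ik; rewrite val_term //.
by have [-> | /(dom i le_ik)] := eqVneq i i0; lia.
Qed.

Hypothesis nza : a != 0.

(** If one term of a B(z) falls below the level T for v(z) = T, it falls even
    below v(z) when v(z) <= T, because d - i >= 1; as no cancellation occurs and
    c is of level T, f(z) falls with it. *)
Lemma scaled_map_escape (T : int) (i n : nat) z :
  T < 0 -> val_ge T c -> (i <= k)%N -> v a + v (b i) + (d - i)%:Z * T < T ->
  z != 0 -> v z <= T -> iter n scaled_map z != 0 /\ v (iter n scaled_map z) <= T.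
Proof.
move=> lt_T0 cT le_ik drop nzz zT; elim: n => [|n [nzy yT]] //=.
move: (iter n _ z) nzy yT => y nzy yT.
have [nzBy /(_ i le_ik) le_By] : _ /\ _ := val_sparse_poly nzy (le_lt_trans yT lt_T0).
have v_aBy := vM nza nzBy.
have lt_aBy : v (a * sparse_poly y) < T.
  have : (d - i)%:Z * v y <= (d - i)%:Z * T by rewrite ler_wpM2l.
  lia.
have [nz ->] : scaled_map y != 0 /\ v (scaled_map y) = v (a * sparse_poly y).
  apply: val_dominant; first by rewrite mulf_neq0.
  by apply: val_ge_le cT; lia.
by split=> //; apply: ltW.
Qed.

(** The case v(c) < 0 comes first: either 0 escapes, or 0 and 1 are brought
    closer by the first step and never get away from each other again.  When v(c)
    is nonnegative, v(a) < 0 makes 1 escape. *)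
Lemma periodic_integral n m : (0 < n)%N -> (0 < m)%N ->
  iter n scaled_map 0 = 0 -> iter m scaled_map 1 = 1 ->
  0 <= v a /\ val_ge 0 c.
Proof.
move=> n_gt0 m_gt0 per0 per1; have [nzu vu] := val_sparse_poly1.
pose u := a * sparse_poly 1; have f1 : scaled_map 1 = u + c by [].
have nz_u : u != 0 by rewrite mulf_neq0.
have v_u : v u = v a by rewrite vM // vu addr0.
have pred_iter N x : (0 < N)%N ->
      iter N scaled_map x = iter N.-1 scaled_map (scaled_map x).
  by move=> N_gt0; rewrite -iterSr prednK.
have le_dr : (2 <= d - r)%N by lia.
have c_ge0 : val_ge 0 c.
  move=> nzc; rewrite leNgt; apply/negP => lt_c0; have cc : val_ge (v c) c by [].
  have [[i le_ik drop] | keep'] := pselect (exists2 i, (i <= k)%N &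
      v a + v (b i) + (d - i)%:Z * v c < v c).
    have [] := scaled_map_escape n.-1 lt_c0 cc le_ik drop nzc (lexx _).
    by rewrite -{1}scaled_map0 -pred_iter // per0 eqxx.
  have keep i : (i <= k)%N -> v c <= v a + v (b i) + (d - i)%:Z * v c.
    by move=> le_ik; rewrite leNgt; apply/negP => drop; apply: keep'; exists i.
  have va_gt0 : 0 < v a.
    have := keep r le_rk; rewrite vbr; nia.
  have contract N : [/\ val_ge (v c) (iter N.+1 scaled_map 1),
      val_ge (v c) (iter N.+1 scaled_map 0)
      & val_ge (v a) (iter N.+1 scaled_map 1 - iter N.+1 scaled_map 0)].
    elim: N => [|N [xc yc xy]].
      rewrite /= f1 scaled_map0; split=> //; last by rewrite addrK => _; rewrite v_u.
      by apply: val_geD => // _; rewrite v_u; lia.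
    have [x1c xy1] := scaled_map_nonexpanding keep cc xc yc xy.
    have y0 : val_ge (v a) (iter N.+1 scaled_map 0 - iter N.+1 scaled_map 0).
      by rewrite subrr; apply: val_ge0.
    by have [y1c _] := scaled_map_nonexpanding keep cc yc yc y0.
  (* After m n steps both 0 and 1 are back. *)
  have [_ _] := contract (m * n).-1; rewrite prednK ?muln_gt0 ?m_gt0 //.
  rewrite [in X in _ - X]iterM (iter_fix _ per0) mulnC iterM (iter_fix _ per1) subr0.
  by move=> /(_ (oner_neq0 _)); rewrite val_1; lia.
split=> //; rewrite leNgt; apply/negP => lt_a0.
have [nzuc v_uc] : u + c != 0 /\ v (u + c) = v u.
  by apply: val_dominant => //; apply: val_ge_le c_ge0; lia.
have ca : val_ge (v a) c by apply: val_ge_le c_ge0; lia.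
have drop : v a + v (b r) + (d - r)%:Z * v a < v a by rewrite vbr; nia.
have v_uca : v (u + c) <= v a by rewrite v_uc v_u.
have [_] := scaled_map_escape m.-1 lt_a0 ca le_rk drop nzuc v_uca.
by rewrite -f1 -pred_iter // per1 val_1; lia.
Qed.

End Dynamics.

End ValuedField.

(** * The Belyi polynomials *)

Section BelyiDynamics.

Variables d k : nat.

Definition belyi_coef (i : nat) : rat :=
  (-1) ^+ (k - i) / ((k - i)`! * i`!)%:R
    * \prod_(j < k.+1 | j != i :> nat) (d%:R - j%:R).

Lemma horner_alg_belyi (A : comAlgType rat) (z : A) :
  horner_alg z (belyi d k) = \sum_(i < k.+1) belyi_coef i *: z ^+ (d - i).
Proof.
rewrite /belyi linear_sum; apply: eq_bigr => i _.
by rewrite linearZ rmorphXn /= horner_algX -scalerAl mul1r.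
Qed.

Lemma eval2_iter n q x y :
  eval2 (iter n (belyi_generic d k) q) x y
  = iter n (scaled_map d k (fun i => ratr (belyi_coef i)) x y) (eval2 q x y).
Proof.
elim: n => //= n <-; rewrite /eval2 /belyi_generic /belyi_map horner_alg_belyi.
rewrite rmorphD rmorphM rmorph_sum /= !mmapX !mmap1U /= !(tnth_nth 0) /=.
rewrite /scaled_map /sparse_poly; congr (_ * _ + _).
by apply: eq_bigr => i _; rewrite mmapZ rmorphXn.
Qed.

(** The equations F_n = G_m = 0 hold in the algebraic numbers; this brings them
    back to L, where P lives. *)
Lemma rmorph_scaled_map (L : fieldExtType rat) (iota : {rmorphism L -> algC}) n a b z :
  iota (iter n (scaled_map d k (fun i => (belyi_coef i)%:A) a b) z)
  = iter n (scaled_map d k (fun i => ratr (belyi_coef i)) (iota a) (iota b)) (iota z).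
Proof.
elim: n => //= n <-; rewrite /scaled_map /sparse_poly rmorphD rmorphM rmorph_sum.
congr (_ * _ + _); apply: eq_bigr => i _; rewrite rmorphM rmorphXn; congr (_ * _).
exact: (fmorph_eq_rat (iota \o in_alg L)).
Qed.

End BelyiDynamics.

Section BelyiCoefficients.

Variables (L : fieldExtType rat) (P : set L) (p : nat).
Hypotheses (P_prime : is_nonzero_prime P) (p_pr : prime p) (Pp : P p%:R).

Let vM := valuationM P_prime p_pr Pp.

Lemma valuation_prod0 (I : finType) (Q : pred I) (E : I -> L) :
  (forall i, Q i -> E i != 0 /\ valuation P (E i) = 0) ->
  \prod_(i | Q i) E i != 0 /\ valuation P (\prod_(i | Q i) E i) = 0.
Proof.
move=> vE; pose U x := x != 0 /\ valuation P x = 0; apply: (big_ind U) => //.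
  by split; [exact: oner_neq0 | exact: (val_1 vM)].
by move=> x y [nzx vx] [nzy vy]; split; [rewrite mulf_neq0 | rewrite vM // vx vy].
Qed.

Lemma valuation_fact i : (i < p)%N -> i`!%:R != 0 :> L /\ valuation P i`!%:R = 0.
Proof.
move=> lt_ip; split.
  by rewrite pmulrn intr_fieldExt_eq0 eqz_nat -lt0n fact_gt0.
apply: (valuation_unit P_prime p_pr Pp); first exact: integers_nat.
rewrite pmulrn; apply: (pideal_notin_int P_prime p_pr Pp).
rewrite dvdzE /= fact_prod big_nat_cond.
apply: (big_ind (fun x => ~~ (p %| x)%N)) => [|x y nx ny|j].
- by rewrite dvdn1; apply: contraTneq p_pr => ->.
- by rewrite Euclid_dvdM // negb_or nx.
- rewrite andbT => /andP[lt0j lt_ji]; apply/negP => /dvdn_leq; lia.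
Qed.

Variables d k r : nat.
Hypotheses (lt_kp : (k < p)%N) (le_rk : (r <= k)%N) (Pdr : P (d%:R - r%:R)).

(** Otherwise P would contain the nonzero integer j - r, of absolute value at
    most k < p. *)
Lemma belyi_factor_notin j : (j <= k)%N -> j != r -> ~ P (d%:R - j%:R).
Proof.
move=> le_jk ne_jr Pdj; apply: (pideal_notin_int P_prime p_pr Pp (c := j%:Z - r%:Z)).
  rewrite dvdzE; apply/negP => /dvdn_leq.
  by rewrite absz_gt0 subr_eq0 eqz_nat ne_jr; lia.
have := pidealD P_prime Pdr (pidealN P_prime Pdj); congr P.
rewrite rmorphB /=; ring.
Qed.

Hypothesis lt_kd : (k < d)%N.

(** Up to a unit the coefficient is the product of the d - j with j <> i, and
    d - r is the only one of these that is not a unit. *)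
Lemma valuation_belyi_coef i : (i <= k)%N ->
  (belyi_coef d k i)%:A != 0 :> L
  /\ valuation P (belyi_coef d k i)%:A
     = if i == r then 0 else valuation P (d%:R - r%:R).
Proof.
move=> le_ik; pose e : L := (-1) ^+ (k - i) / ((k - i)`!%:R * i`!%:R).
have -> : (belyi_coef d k i)%:A = e * \prod_(j < k.+1 | j != i :> nat) (d%:R - j%:R).
  rewrite -[_%:A]/(in_alg L _) /belyi_coef 2!rmorphM fmorphV rmorphXn rmorphN1.
  rewrite rmorph_nat natrM rmorph_prod; congr (_ * _).
  by apply: eq_bigr => j _; rewrite rmorphB !rmorph_nat.
have [nze ve] : e != 0 /\ valuation P e = 0.
  have [nz1 v1] := valuation_fact (leq_ltn_trans (leq_subr i k) lt_kp).
  have [nz2 v2] := valuation_fact (leq_ltn_trans le_ik lt_kp).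
  have nzs : (-1) ^+ (k - i) != 0 :> L by rewrite signr_eq0.
  have nz12 := mulf_neq0 nz1 nz2; split; first by rewrite mulf_neq0 ?invr_eq0.
  rewrite vM ?invr_eq0 // (val_V vM) // vM // v1 v2 (val_X vM) ?oppr_eq0 ?oner_neq0 //.
  by rewrite (val_N vM) (val_1 vM) mulr0.
clearbody e.
have factor0 j : (j <= k)%N -> j != r ->
    d%:R - j%:R != 0 :> L /\ valuation P (d%:R - j%:R) = 0.
  move=> le_jk ne_jr; split; first exact/natrB_neq0/(leq_ltn_trans le_jk).
  apply: (valuation_unit P_prime p_pr Pp); last exact: belyi_factor_notin.
  by apply: integersD; [|apply: integersN]; apply: integers_nat.
pose ord_r := Ordinal (le_rk : (r < k.+1)%N).
have [-> | ne_ir] := eqVneq i r.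
  have [nz vprod] : _ /\ _ := valuation_prod0
    (fun (j : 'I_k.+1) (ne_jr : j != r :> nat) => factor0 j (ltn_ord j) ne_jr).
  by split; [rewrite mulf_neq0 | rewrite vM // ve vprod].
rewrite (bigD1 ord_r) /=; last by rewrite eq_sym.
set rest := \prod_(j < _ | _) _; have [nz vrest] : rest != 0 /\ valuation P rest = 0.
  apply: valuation_prod0 => j /andP[_ ne_jr]; apply: factor0 => //.
  by rewrite -ltnS.
have nzr := natrB_neq0 L (leq_ltn_trans le_rk lt_kd).
by split; [rewrite !mulf_neq0 | rewrite vM ?mulf_neq0 // ve vM // vrest add0r addr0].
Qed.

End BelyiCoefficients.

Theorem proposition11 (d k n m : nat)
  (hd : (3 <= d)%N) (hk1 : (1 <= k)%N) (hk : (k <= uphalf (d - 2))%N)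
  (hn : (1 <= n)%N) (hm : (1 <= m)%N)
  (alpha beta : algC)
  (hF : eval2 (F d k n) alpha beta = 0)
  (hG : eval2 (G d k m) alpha beta = 0)
  (L : fieldExtType rat) (iota : {rmorphism L -> algC}) (a b : L)
  (ha : iota a = alpha) (hb : iota b = beta)
  (hL : <<1 & [:: a; b]>>%VS = fullv)
  (P : set L) (hP : index_divisor_free P d k) :
  padic_integral P a /\ padic_integral P b.
Proof.
have [P_prime [p [p_pr Pp] [lt_kp [r [le_rk Pdr ndv]]]]] := hP.
have lt_kd : (k.+1 < d)%N.
  by have := odd_double_half (d - 2); rewrite uphalf_half in hk; lia.
set f := scaled_map d k (fun i => (belyi_coef d k i)%:A) a b.
have per0 : iter n f 0 = 0.
  apply: (fmorph_inj iota); rewrite rmorph_scaled_map ha hb rmorph0.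
  by apply: etrans hF; rewrite /F eval2_iter /eval2 rmorph0.
have per1 : iter m f 1 = 1.
  apply: (fmorph_inj iota); rewrite rmorph_scaled_map ha hb rmorph1.
  apply: subr0_eq; apply: etrans hG.
  rewrite /G /eval2 rmorphB rmorph1 /= -[mmap _ _ _]/(eval2 _ alpha beta).
  by rewrite eval2_iter /eval2 rmorph1.
have [a0 | nza] := eqVneq a 0.
  (* Then f is the constant b, and 0 can only be periodic if b = 0. *)
  split; rewrite /padic_integral; first by rewrite a0 eqxx.
  suff -> : b = 0 by rewrite eqxx.
  by move: per0; rewrite -(prednK hn) /= /f /scaled_map a0 mul0r add0r.
have coefP :=
  valuation_belyi_coef P_prime p_pr Pp lt_kp le_rk Pdr (ltnW lt_kd).
have w_gt0 : 0 < valuation P (d%:R - r%:R).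
  apply: (valuation_pideal_gt0 P_prime p_pr Pp Pdr).
  exact/natrB_neq0/(leq_ltn_trans le_rk)/ltnW.
pose b_ i : L := (belyi_coef d k i)%:A.
have nzb i : (i <= k)%N -> b_ i != 0 by move=> /coefP[].
have vbr : valuation P (b_ r) = 0 by have [_ ->] := coefP r le_rk; rewrite eqxx.
have vb i : (i <= k)%N -> i != r -> valuation P (b_ i) = valuation P (d%:R - r%:R).
  by move=> le_ik /negPf ne_ir; have [_ ->] := coefP i le_ik; rewrite ne_ir.
have [va vc] := periodic_integral (valuationM P_prime p_pr Pp)
  (valuationD_ge P_prime p_pr Pp) lt_kd le_rk nzb vbr w_gt0 vb ndv nza hn hm per0 per1.
by split.
Qed.
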